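(* Let $\mathbf{A}$ be an epireflective subcategory of $\mathbf{Top}$ with $I_2\notin\mathbf{A}$ and let $\mathbf{B}$ be an HAD-class in $\mathbf{A}$. Suppose that $\mathbf{B}$ contains a space $Y$ such that $P(b,Y,Z)$ holds for some $Z\in\mathbf{A}$ and some non-isolated point $b\in Y$ such that the set $\{b\}$ is closed in $Y$. Then $\mathbf{B}$ is closed under the formation of prime factors.
   Context: $\mathbf{Top}$ is the category of topological spaces and continuous maps. All subcategories are full and isomorphism-closed (so they are identified with classes of spaces), and every subcategory of $\mathbf{Top}$ is assumed to contain at least one space with at least two points. A subcategory of $\mathbf{Top}$ is epireflective in $\mathbf{Top}$ if and only if it is closed under topological products and subspaces. $I_2$ is the two-point indiscrete space. A class $\mathbf{B}\subseteq\mathbf{A}$ is an AD-class in $\mathbf{A}$ if it is additive (closed under topological sums, i.e. disjoint unions) and divisible in $\mathbf{A}$ (if $q\colon X\to Y$ is a quotient map with $X\in\mathbf{B}$ and $Y\in\mathbf{A}$, then $Y\in\mathbf{B}$). It is an HAD-class in $\mathbf{A}$ if moreover it is hereditary, i.e. closed under subspaces. For a space $X$ and $a\in X$, the prime factor $X_a$ of $X$ at $a$ is the space on the same set in which all points different from $a$ are isolated and the neighborhoods of $a$ are the same as in $X$. A class $\mathbf{B}$ is closed under the formation of prime factors if $X_a\in\mathbf{B}$ for all $X\in\mathbf{B}$ and $a\in X$. Let $Y,Z$ be topological spaces and $b\in Y$ a point such that $\{b\}$ is closed in $Y$. One says that $P(b,Y,Z)$ holds if there exist an open local base $\mathcal{B}$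 at $b$ in $Y$, a point $a\in Z$ and an open neighborhood $U_0$ of $a$ in $Z$ such that for every $V\in\mathcal{B}$ there exists a continuous map $f\colon Y\to Z$ with $f(b)=a$ and $f^{-1}(U_0)=V$. *)

(* Defs.v *)
From HB Require Import structures.
From mathcomp Require Import all_boot.
From mathcomp Require Import boolp classical_sets functions filter.
From mathcomp Require Import topology.

Set Implicit Arguments.
Unset Strict Implicit.
Unset Printing Implicit Defensive.

Local Open Scope classical_set_scope.

(* A full subcategory of Top is a class of spaces.  [topologicalType] also
   carries a choice structure, which invariance under homeomorphism makes
   irrelevant. *)
Definition space_class := topologicalType -> Prop.

Definition homeomorphic (X Y : topologicalType) : Prop :=
  exists (f : X -> Y) (g : Y -> X),
    [/\ continuous f, continuous g, cancel f g & cancel g f].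

Definition subcategory (A : space_class) : Prop :=
  (forall X Y : topologicalType, homeomorphic X Y -> A X -> A Y) /\
  (exists X : topologicalType, A X /\ exists x y : X, x <> y).

Definition epi (X Y : topologicalType) (f : X -> Y) : Prop :=
  continuous f /\
  forall (Z : topologicalType) (g h : Y -> Z),
    continuous g -> continuous h -> g \o f = h \o f -> g = h.

Definition reflection (A : space_class) (X RX : topologicalType)
    (r : X -> RX) : Prop :=
  [/\ A RX, continuous r &
    forall (Z : topologicalType) (f : X -> Z), A Z -> continuous f ->
      exists! g : RX -> Z, continuous g /\ g \o r = f].

Definition epireflective (A : space_class) : Prop :=
  forall X : topologicalType,
    exists (RX : topologicalType) (r : X -> RX), reflection A r /\ epi r.

Definition quotient_map (X Y : topologicalType) (q : X -> Y) : Prop :=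
  (forall y, exists x, q x = y) /\
  (forall U : set Y, open U <-> open (q @^-1` U)).

Definition additive (B : space_class) : Prop :=
  forall (I : choiceType) (X : I -> topologicalType),
    (forall i, B (X i)) -> B ({i : I & X i} : topologicalType).

Definition divisible_in (A B : space_class) : Prop :=
  forall (X Y : topologicalType) (q : X -> Y),
    quotient_map q -> B X -> A Y -> B Y.

(* [set_type S] carries the topology induced by the inclusion in [X]; the
   library's [subspace S] is a topology on the whole of [X] instead. *)
Definition hereditary (B : space_class) : Prop :=
  forall (X : topologicalType) (S : set X),
    B X -> B (set_type S : topologicalType).

Definition AD_class (A B : space_class) : Prop :=
  [/\ forall X, B X -> A X, additive B & divisible_in A B].

Definition HAD_class (A B : space_class) : Prop :=
  AD_class A B /\ hereditary B.

Definition I2 : Type := bool.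

Section indiscrete.

Definition I2_open : set_system I2 := [set U | U = set0 \/ U = setT].

Local Lemma I2_openT : I2_open setT.
Proof. by right. Qed.

Local Lemma I2_openI : setI_closed I2_open.
Proof.
move=> U V [] -> [] ->; rewrite ?set0I ?setI0 ?setTI; by [left|right].
Qed.

Local Lemma I2_open_bigU (J : Type) (f : J -> set I2) :
  (forall i, I2_open (f i)) -> I2_open (\bigcup_i f i).
Proof.
move=> fo; case: (pselect (exists i, f i = setT)) => [[i fi]|nf].
  by right; apply/seteqP; split=> // x _; exists i => //; rewrite fi.
left; apply/seteqP; split=> // x [i _].
by case: (fo i) => [-> //|fi]; case: nf; exists i.
Qed.

HB.instance Definition _ := Choice.on I2.
HB.instance Definition _ :=
  isOpenTopological.Build I2 I2_openT I2_openI I2_open_bigU.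

End indiscrete.

Definition prime_factor (X : topologicalType) (a : X) : Type := X.

Section prime_factor.
Context (X : topologicalType) (a : X).
Local Notation Xa := (prime_factor a).

Definition prime_factor_nbhs (x : Xa) : set_system Xa :=
  if x == a :> X then nbhs a else principal_filter x.

Local Lemma prime_factor_nbhs_filter x : ProperFilter (prime_factor_nbhs x).
Proof.
rewrite /prime_factor_nbhs; case: eqP => _; first exact: nbhs_pfilter.
exact: principal_filter_proper.
Qed.

Local Lemma prime_factor_nbhs_singleton x (U : set Xa) :
  prime_factor_nbhs x U -> U x.
Proof.
rewrite /prime_factor_nbhs; case: eqP => [->|_]; first exact: nbhs_singleton.
by move/principal_filterP.
Qed.

Local Lemma prime_factor_nbhs_nbhs x (U : set Xa) :
  prime_factor_nbhs x U -> prime_factor_nbhs x (prime_factor_nbhs^~ U).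
Proof.
rewrite {1 2}/prime_factor_nbhs; case: eqP => [_|xa] Ux.
  have : nbhs a U by [].
  apply: filterS => y Uy; rewrite /prime_factor_nbhs.
  by case: eqP => // _; apply/principal_filterP.
apply/principal_filterP; rewrite /prime_factor_nbhs.
by case: eqP xa.
Qed.

HB.instance Definition _ := Choice.on Xa.
HB.instance Definition _ := hasNbhs.Build Xa prime_factor_nbhs.
HB.instance Definition _ := Nbhs_isNbhsTopological.Build Xa
  prime_factor_nbhs_filter prime_factor_nbhs_singleton prime_factor_nbhs_nbhs.

End prime_factor.

Definition prime_factor_closed (B : space_class) : Prop :=
  forall (X : topologicalType) (a : X),
    B X -> B (prime_factor a : topologicalType).

Definition open_local_base (Y : topologicalType) (b : Y)
    (L : set (set Y)) : Prop :=
  L `<=` open_nbhs b /\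
  forall U : set Y, nbhs b U -> exists2 V, L V & V `<=` U.

(* Only meaningful when [[set b]] is closed, which is assumed separately. *)
Definition property_P (Y : topologicalType) (b : Y) (Z : topologicalType) :
    Prop :=
  exists (L : set (set Y)) (a : Z) (U0 : set Z),
    [/\ open_local_base b L, open_nbhs a U0 &
      forall V, L V ->
        exists f : Y -> Z, [/\ continuous f, f b = a & f @^-1` U0 = V]].

(* Main.v *)
(** Glue a copy of [Y] at [b] to every point of [X].  The resulting space is
    a quotient of a sum of [X] and copies of [Y], and [property_P] ensures
    that its topology is initial for maps into [X], [Y] and [Z], so that it
    lies in [A] and hence in [B].  Delete from it all points [x <> a] of [X]
    and all points [y <> b] of the copy glued at [a]: collapsing each remaining
    [Y \ {b}] to a point is a quotient map onto the prime factor of [X] at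
    [a], because [b] is not isolated. *)
Require Import Defs.
From HB Require Import structures.
From mathcomp Require Import all_boot.
From mathcomp Require Import boolp classical_sets functions filter.
From mathcomp Require Import topology.

Local Open Scope classical_set_scope.

(** * Indiscrete spaces, epimorphisms and reflections *)

Lemma I2_continuous (X : topologicalType) (f : X -> I2) : continuous f.
Proof.
apply/continuousP => U [] ->; first by rewrite preimage_set0; exact: open0.
by rewrite preimage_setT; exact: openT.
Qed.

Lemma open_cst (X : topologicalType) (P : Prop) : open [set _ : X | P].
Proof.
case: (pselect P) => p.
  by rewrite (_ : [set _ | _] = setT); [exact: openT|apply/seteqP; split].
by rewrite (_ : [set _ | _] = set0); [exact: open0|apply/seteqP; split].
Qed.

Lemma not_isolatedP {Y : topologicalType} {b : Y} :
  ~ isolated [set: Y] b ->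
  forall V : set Y, nbhs b V -> exists2 y, V y & y <> b.
Proof.
move=> nib V Vb; apply: contrapT => nV; apply: nib; split; first exact: mem_set.
exists V => //; rewrite setIT; apply/seteqP; split=> [y Vy|_ ->].
  by apply: contrapT => yb; apply: nV; exists y.
exact: nbhs_singleton.
Qed.

(** Every map into [I2] is continuous, so the indicator of a missed point and the constant [false]
    would be two different maps agreeing after [f]. *)
Lemma epi_surjective (X Y : topologicalType) (f : X -> Y) :
  epi f -> forall y, exists x, f x = y.
Proof.
move=> [_ epif] y; apply: contrapT => ny.
pose g (z : Y) : I2 := `[< z = y >].
have gf : g \o f = (fun=> false) \o f.
  by apply/funext => x /=; rewrite /g asboolF// => fxy; apply: ny; exists x.
have := epif I2 g (fun=> false) (I2_continuous _ _) (I2_continuous _ _) gf.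
by move/(congr1 (fun h => h y)); rewrite /g asboolT.
Qed.

(* The hypotheses say that [X] carries the initial topology for the
   point-separating family of all continuous maps into members of [A]. *)
Lemma epireflective_initial (A : space_class) (X : topologicalType) :
  subcategory A -> epireflective A ->
  (forall x y : X, (forall (Z : topologicalType) (f : X -> Z),
      A Z -> continuous f -> f x = f y) -> x = y) ->
  (forall (F : set_system X) (x : X), Filter F ->
    (forall (Z : topologicalType) (f : X -> Z),
      A Z -> continuous f -> f @ F --> f x) -> F --> x) ->
  A X.
Proof.
move=> [isoA _] epiA sepX initX.
have [RX [r [[ARX cr ext] epir]]] := epiA X.
have [s rs] := choice (epi_surjective _ _ _ epir).
(* Maps into members of [A] factor through [r], so they cannot separate [s (r x)] from [x]. *)
have sr : cancel r s.
  move=> x; apply: sepX => Z f AZ cf.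
  have [g [[cg gr] _]] := ext Z f AZ cf.
  by rewrite -gr /= rs.
(* The inverse [s] is continuous because [f \o s] is the extension of [f] for each test map [f]. *)
apply: isoA ARX; exists s, r; split => //.
move=> t; apply: initX => Z f AZ cf.
have [g [[cg gr] _]] := ext Z f AZ cf.
have fsE : f \o s = g by rewrite -gr; apply/funext => u /=; rewrite rs.
by have := cg t; rewrite -fsE.
Qed.

(** Two distinct points with the same open neighborhoods would span an indiscrete subspace, and its
    embedding [i] would put [I2] into [A]. *)
Lemma epireflective_T0 (A : space_class) (X : topologicalType) :
  subcategory A -> epireflective A -> ~ A (I2 : topologicalType) -> A X ->
  forall x y : X, (forall U, open U -> U x <-> U y) -> x = y.
Proof.
move=> subA epiA nI2 AX x y xyU; apply: contrapT => xy; apply: nI2.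
pose i (u : I2) := if u then x else y.
have ci : continuous i.
  apply/continuousP => U oU; case: (pselect (U x)) => Ux.
    right; apply/seteqP; split=> // -[] _ //=.
    by apply/(xyU _ oU).
  left; apply/seteqP; split=> // -[] //= Uy.
  by apply: Ux; apply/(xyU _ oU).
apply: epireflective_initial => //.
  move=> u v uv; have := uv _ _ AX ci.
  by case: u {uv}; case: v => //= /esym.
move=> F u FF _ U; rewrite nbhsE => -[V [[->|->] Vu] VU] //.
by apply: filterS VU _; exact: filterT.
Qed.

(** * Prime factors in epireflective subcategories *)

Lemma prime_factor_continuous (X Z : topologicalType) (a : X)
    (f : X -> Z) :
  f @ nbhs a --> f a -> continuous (f : prime_factor a -> Z).
Proof.
move=> fa x U Ufx; rewrite /nbhs /= /prime_factor_nbhs.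
case: eqP Ufx => [->|_] Ufx; first exact: fa.
apply/principal_filterP; exact: nbhs_singleton Ufx.
Qed.

Lemma epireflective_prime_factor (A : space_class) (X Y : topologicalType)
    (a : X) (b c : Y) :
  subcategory A -> epireflective A -> ~ A (I2 : topologicalType) ->
  A X -> A Y -> closed [set b] -> c <> b ->
  A (prime_factor a : topologicalType).
Proof.
move=> subA epiA nI2 AX AY clb cb.
have cid : continuous (id : prime_factor a -> X).
  exact: prime_factor_continuous.
apply: epireflective_initial => //.
  by move=> x y /(_ X id AX cid).
move=> F x FF Fx U; rewrite /nbhs /= /prime_factor_nbhs.
case: eqP => [xa|xa Ux]; first by rewrite -xa; exact: Fx cid U.
(* [{x}] is the preimage of an open set of [Y] or of [X]. *)
suff [Z [f [V [AZ cf oV Vx VU]]]] : exists (Z : topologicalType)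
    (f : prime_factor a -> Z) (V : set Z),
    [/\ A Z, continuous f, open V, V (f x) & forall y, V (f y) -> y = x].
  have : F (f @^-1` V) by apply: (Fx Z f AZ cf); exact: open_nbhs_nbhs.
  apply: filterS => y /VU ->; exact: (principal_filterP _ _).1 Ux.
(* If [x] lies in every neighborhood of [a], the map fixing [x] and sending the rest to [a] is
   continuous at [a], and the T0 property separates its two values. Otherwise some neighborhood of
   [a] misses [x], so a map may be [b] there and [c] at [x]. *)
case: (pselect (forall V : set X, open V -> V a -> V x)) => [ax|nax].
  have [V [oV Vx Va]] : exists V : set X, [/\ open V, V x & ~ V a].
    apply: contrapT => nV; apply: xa.
    apply: (epireflective_T0 _ _ subA epiA nI2 AX) => V oV.
    split=> [Vx|]; last exact: ax.
    by apply: contrapT => Va; apply: nV; exists V.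
  exists X, (fun y => if y == x :> X then x else a), V; split => //.
  - apply: prime_factor_continuous; rewrite [X in _ --> X]/=.
    have -> : (if a == x then x else a) = a by case: eqP.
    move=> W Wa; have aU : nbhs a [set: X] by exact: filterT.
    apply: filterS aU => y _ /=; case: ifP => _; last exact: nbhs_singleton.
    exact: (@interior_subset X W _ (ax _ (open_interior W) Wa)).
  - by rewrite /= eqxx.
  - by move=> y; case: eqP => // _ /Va.
have [V [oV Va Vx]] : exists V : set X, [/\ open V, V a & ~ V x].
  apply: contrapT => nV; apply: nax => V oV Va.
  by apply: contrapT => Vx; apply: nV; exists V.
exists Y, (fun y => if y == x :> X then c else b), (~` [set b]); split => //.
- apply: prime_factor_continuous; rewrite [X in _ --> X]/=.
  have -> : (if a == x then c else b) = b by case: eqP xa => // ->.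
  move=> W /nbhs_singleton Wb.
  have : nbhs a V by exact: open_nbhs_nbhs.
  by apply: filterS => y Vy /=; case: eqP Vy => // ->.
- exact: closed_openC.
- by rewrite /= eqxx.
- by move=> y /=; case: eqP => // _ /(_ erefl).
Qed.

(* The point [(x, b)] is the point [x] of [X], and [{x} * Y] is the copy of
   [Y] glued at [x]. *)
Definition whisker (X Y : topologicalType) (b : Y) : Type := (X * Y)%type.
Arguments whisker X {Y} b.

(** * The glued space *)

Section whisker.
Context (X Y : topologicalType) (b : Y).
Local Notation W := (whisker X b).

(** The final topology for the inclusions of [X] and of all copies of [Y], in general finer than the
    product topology. *)
Definition whisker_open : set_system W :=
  [set O | (forall x, open [set y | O (x, y)]) /\ open [set x | O (x, b)]].

Local Lemma whisker_openT : whisker_open setT.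
Proof. by split=> [x|]; exact: open_cst. Qed.

Local Lemma whisker_openI : setI_closed whisker_open.
Proof.
by move=> O P [Ox Ob] [Px Pb]; split=> [x|];
  [exact: openI (Ox x) (Px x)|exact: openI Ob Pb].
Qed.

Local Lemma whisker_open_bigU (J : Type) (f : J -> set W) :
  (forall i, whisker_open (f i)) -> whisker_open (\bigcup_i f i).
Proof.
move=> fo; split=> [x|].
  rewrite (_ : mkset _ = \bigcup_i [set y | f i (x, y)]) //.
  by apply: bigcup_open => i _; exact: (fo i).1.
rewrite (_ : mkset _ = \bigcup_i [set x | f i (x, b)]) //.
by apply: bigcup_open => i _; exact: (fo i).2.
Qed.

HB.instance Definition _ := Choice.on W.
HB.instance Definition _ :=
  isOpenTopological.Build W whisker_openT whisker_openI whisker_open_bigU.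

Lemma whisker_openP (O : set W) :
  open O <->
  (forall x, open [set y | O (x, y)]) /\ open [set x | O (x, b)].
Proof. by []. Qed.

Lemma whisker_continuous (Z : topologicalType) (f : W -> Z) :
  (forall x, continuous (fun y => f (x, y))) ->
  continuous (fun x => f (x, b)) -> continuous f.
Proof.
move=> fx fb; apply/continuousP => O oO; apply/whisker_openP; split=> [x|].
  by move/continuousP: (fx x); exact.
by move/continuousP: fb; exact.
Qed.

Definition whisker_part (i : option X) : topologicalType :=
  if i is Some _ then Y else X.

Definition whisker_glue (w : {i : option X & whisker_part i}) : W :=
  match w with
  | existT (Some x) y => (x, y)
  | existT None x => (x, b)
  end.

Lemma whisker_glue_quotient : quotient_map whisker_glue.
Proof.
split=> [[x y]|O].
  by exists (existT whisker_part (Some x) y).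
rewrite whisker_openP; split=> [[Ox Ob]|/sigT_openP oO].
  by apply/sigT_openP => -[x|]; [exact: Ox|exact: Ob].
by split=> [x|]; [exact: (oO (Some x))|exact: (oO None)].
Qed.

Lemma epireflective_whisker (A : space_class) (Z : topologicalType) :
  subcategory A -> epireflective A -> A X -> A Y -> A Z ->
  closed [set b] -> property_P b Z -> A (W : topologicalType).
Proof.
move=> subA epiA AX AY AZ clb [L [a [U0 [[Lnb Lbase] [oU0 U0a] Lf]]]].
have cfst : continuous (fst : W -> X).
  by apply: whisker_continuous => [x|] t; [exact: cvg_cst|exact: cvg_id].
pose leaf (x : X) (w : W) := if w.1 == x then w.2 else b.
have cleaf x : continuous (leaf x).
  apply: whisker_continuous => [x'|]; rewrite /leaf /=.
    by case: eqP => _ t; [exact: cvg_id|exact: cvg_cst].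
  rewrite (_ : (fun _ => _) = fun=> b); first by move=> t; exact: cvg_cst.
  by apply/funext => x'; case: ifP.
have leaf_id x y : leaf x (x, y) = y by rewrite /leaf /= eqxx.
apply: epireflective_initial => //.
  move=> [x y] [x' y'] E; have /= xx' := E _ _ AX cfst.
  by have := E _ _ AY (cleaf x); rewrite leaf_id -xx' leaf_id => ->.
move=> F [x y] FF Fw O; rewrite nbhsE => -[P [/whisker_openP[Px Pb] Pxy] PO].
apply: filterS PO _.
case: (pselect (y = b)) => [yb|yb]; last first.
  (* Away from the gluing points one retraction suffices: [leaf x] differs from [b] only on the copy
     at [x]. *)
  pose N := [set y' | P (x, y')] `&` ~` [set b].
  have : F (leaf x @^-1` N).
    apply: (Fw _ _ AY (cleaf x)); rewrite leaf_id; apply: open_nbhs_nbhs.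
    by split; [apply: openI => //; exact: closed_openC|split].
  apply: filterS => -[x' y']; rewrite /leaf /=.
  by case: eqP => [->|_] /= [Py' nyb] //; case: nyb.
(* Since [a] and [U0] serve all basic neighborhoods at once, the maps chosen on the copies agree at
   the gluing points and combine into one continuous [g]. The constant [a] is a default where [P]
   misses [(x', b)]. *)
have /choice[f fP] : forall x', exists f : Y -> Z, [/\ continuous f, f b = a &
    P (x', b) -> f @^-1` U0 `<=` [set y' | P (x', y')]].
  move=> x'.
  case: (pselect (P (x', b))) => Px'; last first.
    by exists (fun=> a); split=> // t; exact: cvg_cst.
  have [V LV VP] := Lbase _ (open_nbhs_nbhs (conj (Px x') Px')).
  by have [g [cg gb gV]] := Lf V LV; exists g; split=> // _; rewrite gV.
pose g (w : W) := f w.1 w.2.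
have cg : continuous g.
  apply: whisker_continuous => [x'|]; rewrite /g /=; first by have [] := fP x'.
  rewrite (_ : (fun _ => _) = fun=> a); first by move=> t; exact: cvg_cst.
  by apply/funext => x'; have [] := fP x'.
have FP : F (fst @^-1` [set x' | P (x', b)]).
  by apply: (Fw _ _ AX cfst); apply: open_nbhs_nbhs; split; rewrite //= -yb.
have FU : F (g @^-1` U0).
  apply: (Fw _ _ AZ cg); apply: open_nbhs_nbhs; split; rewrite // /g /= yb.
  by have [_ ->] := fP x.
apply: filterS (filterI FP FU) => -[x' y'] /= [Px' gU].
by have [_ _] := fP x'; apply.
Qed.

(** * Pruning and collapsing to the prime factor *)

Definition pruned_whisker (a : X) : set W := [set w | w.1 = a <-> w.2 = b].

Lemma pruned_whisker_quotient (a : X) :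
  closed [set b] -> ~ isolated [set: Y] b ->
  quotient_map
    (fun w : set_type (pruned_whisker a) => (\val w).1 : prime_factor a).
Proof.
move=> clb /not_isolatedP nib.
have mem_pruned x y : pruned_whisker a (x, y) ->
    exists w : set_type (pruned_whisker a), \val w = (x, y).
  by move=> xy; exists (exist _ (x, y) (mem_set xy)).
split=> [x|U].
  have [c _ cb] := nib setT filterT.
  case: (pselect (x = a)) => [->|xa].
    by have [//|w wE] := mem_pruned a b; exists w; rewrite wE.
  by have [//|w wE] := mem_pruned x c; exists w; rewrite wE.
split=> [oU|[O /whisker_openP[Ox Ob] OU]].
  (* Restricting the gluing points to the interior of [U] in [X] makes the set open. Pruning leaves
     only the gluing point [(a, b)], and [a] is interior to [U] whenever it belongs to [U]. *)
  exists [set w : W | U w.1 /\ (w.2 = b -> (U : set X)^° w.1)].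
    apply/whisker_openP; split=> [x|] /=.
      case: (pselect ((U : set X)^° x)) => [Ux|nUx].
        rewrite (_ : mkset _ = [set _ | True]); first exact: open_cst.
        by apply/seteqP; split=> // y _; split=> //; exact: interior_subset Ux.
      rewrite (_ : mkset _ = [set _ | U x] `&` ~` [set b]).
        by apply: openI; [exact: open_cst|exact: closed_openC].
      by apply/seteqP; split=> y /= [Ux yb]; split=> // /yb.
    rewrite (_ : mkset _ = (U : set X)^°); first exact: open_interior.
    apply/seteqP; split=> x /=; first by case=> _; exact.
    by move=> Ux; split=> //; exact: interior_subset Ux.
  apply/seteqP; split=> -[[x y] xyS] /=; first by case.
  move=> Ux; split=> // yb.
  have xa : x = a by have [_] := set_mem xyS; exact.
  rewrite xa in Ux *.
  have : nbhs (a : prime_factor a) U by exact: open_nbhs_nbhs.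
  by rewrite {1}/nbhs /= /prime_factor_nbhs eqxx.
rewrite openE => x Ux; rewrite /interior /nbhs /= /prime_factor_nbhs.
case: eqP Ux => [-> Ua|_ Ux]; last exact/principal_filterP.
have OUE x' y : pruned_whisker a (x', y) -> O (x', y) <-> U x'.
  move=> /mem_pruned[w wE].
  have : (\val @^-1` O) w <-> U (\val w).1 by rewrite OU.
  by rewrite /= wE.
have : nbhs a [set x' | O (x', b)].
  by apply: open_nbhs_nbhs; split=> //; apply/OUE.
apply: filterS => x' /= Ox'.
case: (pselect (x' = a)) => [->//|x'a].
(* As [b] is not isolated, [O] contains a point of the copy at [x'] that survives pruning, which
   forces [x'] into [U]. *)
have [y Oy yb] := nib _ (open_nbhs_nbhs (conj (Ox x') Ox')).
exact/(OUE x' y).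
Qed.

End whisker.

Theorem theorem3p10 (A B : space_class)
    (subA : subcategory A) (epiA : epireflective A)
    (nI2 : ~ A (I2 : topologicalType))
    (subB : subcategory B) (hadB : HAD_class A B)
    (hP : exists (Y Z : topologicalType) (b : Y),
        [/\ B Y, A Z, ~ isolated [set: Y] b, closed [set b] &
            property_P b Z]) :
  prime_factor_closed B.
Proof.
move=> X a BX; have [[BA addB divB] herB] := hadB.
have [Y [Z [b [BY AZ nib clb PbZ]]]] := hP.
have AX := BA _ BX; have AY := BA _ BY.
have [c _ cb] := not_isolatedP nib _ filterT.
have BW : B (whisker X b : topologicalType).
  apply: divB (whisker_glue_quotient X Y b) _ _.
    by apply: addB => -[].
  exact: epireflective_whisker AZ _ _.
apply: divB (pruned_whisker_quotient X Y b a clb nib) _ _.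
  exact: herB.
exact: epireflective_prime_factor AX AY clb cb.
Qed.
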